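(* Let $X$ be a set, let $\mathcal{A}$ be an algebra of subsets of $X$, and let $m\colon\mathcal{A}\to[0,\infty]$ be a measure on $\mathcal{A}$. Let $\mathcal{M}$ be the set of all subsets of $X$ that are locally approximable by sets in $\mathcal{A}$, that is, $$\mathcal{M}:=\{E\subseteq X\colon \forall A\in\mathcal{A}_{\mathsf{fin}}\ \forall\varepsilon>0\ \exists B\in\mathcal{A}\ \ d_A(E,B)<\varepsilon\}.$$ Then $\mathcal{M}$ is a $\sigma$-algebra over $X$, and $\mathcal{M}\supseteq\mathcal{A}$.
   Context: A measure on an algebra $\mathcal{A}$ over $X$ is a nonnegative function $m\colon\mathcal{A}\to[0,\infty]$ with $m(\emptyset)=0$ that is $\sigma$-additive: $m(\bigcup_n A_n)=\sum_n m(A_n)$ for every disjoint sequence $(A_n)$ in $\mathcal{A}$ with $\bigcup_n A_n\in\mathcal{A}$. Set $\mathcal{A}_{\mathsf{fin}}:=\{A\in\mathcal{A}\colon m(A)<\infty\}$. The outer measure corresponding to $m$ is defined for all $E\subseteq X$ by $m^*(E):=\inf\{\sum_{n=1}^\infty m(A_n)\colon (A_n)_{n=1}^\infty \text{ a sequence in }\mathcal{A},\ \bigcup_n A_n\supseteq E\}$. For $E,F\subseteq X$, $E+F$ denotes the symmetric difference of $E$ and $F$. For $A\in\mathcal{A}$ and $E,F\subseteq X$, $d_A(E,F):=m^*\big(A\cap(E+F)\big)$. *)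

(* Defs.v *)
From mathcomp Require Import all_boot all_order all_algebra.
From mathcomp Require Import all_classical all_reals all_analysis.
Set Implicit Arguments.
Unset Strict Implicit.
Unset Printing Implicit Defensive.
Import Order.TTheory GRing.Theory Num.Theory.
Local Open Scope classical_set_scope.
Local Open Scope ring_scope.
Local Open Scope ereal_scope.

(* The ground set is an arbitrary type [T] and the algebra a set of sets [A].
   MathComp-Analysis's [algebraOfSetsType] and [{measure set T -> \bar R}] are
   not used because they require [T] to be pointed, hence nonempty. *)

Definition algebra_of_sets (T : Type) (A : set (set T)) : Prop :=
  [/\ A set0, setU_closed A & setC_closed A].

(* A function on [A] is represented by a total [m : set T -> \bar R]; nothing
   is assumed about its values outside [A], and no definition below uses them. *)
Definition measure_on (R : realType) (T : Type) (A : set (set T))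
    (m : set T -> \bar R) : Prop :=
  [/\ m set0 = 0,
      forall E, A E -> 0 <= m E &
      forall F : (set T)^nat, (forall n, A (F n)) -> trivIset setT F ->
        A (\bigcup_n F n) -> m (\bigcup_n F n) = \sum_(n <oo) m (F n)].

Definition fin_sets (R : realType) (T : Type) (A : set (set T))
    (m : set T -> \bar R) : set (set T) :=
  [set E | A E /\ m E < +oo].

(* When [A] is the set of measurable sets of a [semiRingOfSetsType], this is
   [mu_ext m] by definition. *)
Definition outer (R : realType) (T : Type) (A : set (set T))
    (m : set T -> \bar R) (E : set T) : \bar R :=
  ereal_inf [set \sum_(n <oo) m (F n) | F in
    [set F : (set T)^nat | (forall n, A (F n)) /\ E `<=` \bigcup_n F n]].

Definition local_dist (R : realType) (T : Type) (A : set (set T))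
    (m : set T -> \bar R) (C E F : set T) : \bar R :=
  outer A m (C `&` (E `+` F)).

Definition locally_approximable (R : realType) (T : Type) (A : set (set T))
    (m : set T -> \bar R) : set (set T) :=
  [set E | forall C, fin_sets A m C -> forall e : R, (0 < e)%R ->
    exists2 B, A B & local_dist A m C E B < e%:E].

(* Main.v *)
Require Import Defs.
From mathcomp Require Import all_boot all_order all_algebra.
From mathcomp Require Import all_classical all_reals all_analysis.
Local Open Scope classical_set_scope.

(** Write m* for the outer measure and M for the family of locally
    approximable sets. A set of the algebra approximates itself without error,
    and E and B have the same symmetric difference as their complements; so the
    content of the theorem is that M is closed under countable unions
    ([locally_approximable_bigcup]).

    Let E_0, E_1, ... be in M, let C be in the algebra with m(C) finite, and
    pick B_n in the algebra so that C cut down to the symmetric difference of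
    E_n and B_n has outer measure below an error that is summable in n. By
    countable subadditivity of m* ([outer_bigcup_le]) the union of the E_n is,
    inside C, close to the union of the B_n. The latter need not be in the
    algebra, but the sets D_n, obtained by removing from C `&` B_n the earlier
    B_k, are disjoint members of the algebra contained in C, so the series of
    their measures converges, being bounded by m(C) ([measure_on_seqDU_le]).
    Here the finiteness of m(C) enters: the tail of the series is
    arbitrarily small, hence so is the outer measure of what is lost in C when
    the union of the B_n is truncated to a finite union. That finite union is
    the required approximation; [bigcup_setY_sub] is the set inclusion that
    combines the two errors. *)

Import Order.TTheory GRing.Theory Num.Theory.
Local Open Scope ereal_scope.

Set Implicit Arguments.
Unset Strict Implicit.
Unset Printing Implicit Defensive.

Lemma algebra_of_setsD (X : Type) (A : set (set X)) :
  algebra_of_sets A -> setD_closed A.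
Proof.
move=> [_ AU AC] E F AE AF; rewrite -[E `\` F]setCK setCD.
by apply/AC/AU => //; exact: AC.
Qed.

Lemma algebra_of_setsI (X : Type) (A : set (set X)) :
  algebra_of_sets A -> setI_closed A.
Proof.
by move=> hA E F AE AF; rewrite -setDD; do !apply: algebra_of_setsD.
Qed.

Lemma algebra_of_sets_bigsetU (X : Type) (A : set (set X)) (F : (set X)^nat) :
  algebra_of_sets A -> (forall k, A (F k)) -> forall n,
  A (\big[setU/set0]_(k < n) F k).
Proof.
by move=> [A0 AU _] AF n; elim/big_ind : _ => // *; exact: AU.
Qed.

Lemma algebra_of_sets_seqDU (X : Type) (A : set (set X)) (F : (set X)^nat) :
  algebra_of_sets A -> (forall k, A (F k)) -> forall n, A (seqDU F n).
Proof.
move=> hA AF n; apply: algebra_of_setsD => //.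
exact: (algebra_of_sets_bigsetU hA AF).
Qed.

(** It suffices to bound each partial sum, and the first N pieces can be filled
    up to a countable partition of C, to which sigma-additivity applies. The
    union of all the pieces cannot be used instead: it need not be in A. *)
Lemma measure_on_seqDU_le (R : realType) (X : Type) (A : set (set X))
    (m : set X -> \bar R) (F : (set X)^nat) (C : set X) :
  algebra_of_sets A -> measure_on A m ->
  (forall k, A (F k)) -> A C -> (forall k, F k `<=` C) ->
  \sum_(n <oo) m (seqDU F n) <= m C.
Proof.
move=> hA [_ m0 mU] AF AC FC.
apply: lime_le.
  by apply: is_cvg_nneseries => n _ _; exact/m0/(algebra_of_sets_seqDU hA AF).
apply: nearW => N.
(* After index N the sequence is C itself, so that disjointifying it yields the
   first N pieces of F, then the remainder of C, then empty sets. *)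
pose G n := if (n < N)%N then F n else C.
have AG n : A (G n) by rewrite /G; case: ifP.
have GC : \bigcup_n seqDU G n = C.
  rewrite -seqDU_bigcup_eq; apply/seteqP; split=> [x [n _]|x Cx].
    by rewrite /G; case: ifP => // _; exact: FC.
  by exists N => //; rewrite /G ltnn.
have AD := algebra_of_sets_seqDU hA AG.
have -> : m C = \sum_(n <oo) m (seqDU G n).
  by rewrite -mU ?GC//; exact: trivIset_seqDU.
apply: le_trans (nneseries_lim_ge N _); last by move=> n _ _; exact: m0.
rewrite big_nat [leRHS]big_nat; apply: lee_sum => n /andP[_ nN].
suff -> : seqDU G n = seqDU F n by [].
rewrite /seqDU {1}/G nN; congr (_ `\` _); apply: eq_bigr => k _.
by rewrite /G (ltn_trans _ nN).
Qed.

Lemma outer_ltP (R : realType) (X : Type) (A : set (set X))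
    (m : set X -> \bar R) (E : set X) (a : \bar R) :
  outer A m E < a -> exists F : (set X)^nat,
  [/\ forall n, A (F n), E `<=` \bigcup_n F n & \sum_(n <oo) m (F n) < a].
Proof. by move=> /ereal_inf_lt[_ [F [AF EF] <-] lta]; exists F. Qed.

Lemma outer_le_cover (R : realType) (X : Type) (A : set (set X))
    (m : set X -> \bar R) (E : set X) (F : (set X)^nat) :
  (forall n, A (F n)) -> E `<=` \bigcup_n F n ->
  outer A m E <= \sum_(n <oo) m (F n).
Proof. by move=> AF EF; apply: ereal_inf_lbound; exists F. Qed.

Lemma le_outer (R : realType) (X : Type) (A : set (set X))
    (m : set X -> \bar R) (E F : set X) :
  E `<=` F -> outer A m E <= outer A m F.
Proof.
move=> EF; apply: ereal_inf_le_tmp => _ [G [AG FG] <-].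
by exists G => //; split=> //; exact: subset_trans FG.
Qed.

(** Countable subadditivity of the outer measure, in terms of strict upper
    bounds: strictness supplies for each S n a cover of total measure below
    a n, and these covers together, enumerated along a bijection of nat with
    nat * nat, cover the union. *)
Lemma outer_bigcup_le (R : realType) (X : Type) (A : set (set X))
    (m : set X -> \bar R) (S : (set X)^nat) (a : (\bar R)^nat) :
  measure_on A m -> (forall n, outer A m (S n) < a n) ->
  outer A m (\bigcup_n S n) <= \sum_(n <oo) a n.
Proof.
move=> [_ m0 _] Sa.
have /choice[F /all_and3[AF SF Fa]] n := outer_ltP (Sa n).
(* f enumerates the pairs (cover, member of that cover). *)
have /card_esym/ppcard_eqP[f] := card_nat2.
apply: (@le_trans _ _ (\sum_(i <oo) m (F (f i).1 (f i).2))).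
  apply: (@outer_le_cover _ _ _ _ _ (fun i => F (f i).1 (f i).2)) => // x.
  move=> [n _ /SF[k _ Fx]]; exists (f^-1%FUN (n, k)) => //=.
  by rewrite invK ?inE.
apply: (@le_trans _ _ (\sum_(n <oo) \sum_(k <oo) m (F n k))); last first.
  apply: lee_nneseries => n *; first by apply: nneseries_ge0 => k *; exact: m0.
  exact/ltW.
rewrite [leRHS](eq_eseriesr (g := fun n => (\esum_(k in setT) m (F n k))%R)); last first.
  by move=> n _; rewrite nneseries_esumT// => k; exact: m0.
rewrite !nneseries_esumT; last 2 first.
- by move=> n; apply: esum_ge0 => k _; exact: m0.
- by move=> i; exact: m0.
rewrite esum_esum; last by move=> *; exact: m0.
rewrite (reindex_esum setT _ f)//.
have -> : setT `*`` (fun=> setT) = setT :> set (nat * nat) by apply/seteqP.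
by rewrite setTT_bijective; exact: bijTT.
Qed.

(** If a point of E n misses the finite union although it lies in B n, then the
    first B k containing it has k >= N, so it lies in a late piece of the
    disjointification. Any other discrepancy at a point of C is one between
    E n and B n for a single n. *)
Lemma bigcup_setY_sub (X : Type) (C : set X) (E B : (set X)^nat) (N : nat) :
  let D n := C `&` B n in
  C `&` (\bigcup_n E n `+` \big[setU/set0]_(k < N) D k) `<=`
  \bigcup_n seqDU D (n + N)%N `|` \bigcup_n (C `&` (E n `+` B n)).
Proof.
move=> D x [Cx]; rewrite -bigcup_mkord => -[[[n _ Ex] nDx]|[[k /= kN [_ Bx]] nEx]].
  have [Bx|nBx] := pselect (B n x); last by right; exists n => //; split=> //; left.
  left; have : (\bigcup_n D n) x by exists n.
  rewrite seqDU_bigcup_eq => -[k _ Dx].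
  have [kN|Nk] := ltnP k N; last by exists (k - N)%N; rewrite ?subnK.
  by case: nDx; exists k => //; case: Dx.
right; exists k => //; split=> //; right; split=> // Ex.
by apply: nEx; exists k.
Qed.

Lemma locally_approximable_sub (R : realType) (X : Type) (A : set (set X))
    (m : set X -> \bar R) :
  algebra_of_sets A -> measure_on A m -> A `<=` locally_approximable A m.
Proof.
move=> [A0 _ _] [m0 _ _] E AE C _ e e0; exists E => //.
rewrite /local_dist setYK setI0.
apply: (@le_lt_trans _ _ (\sum_(n <oo) m set0)).
  exact: (@outer_le_cover _ _ _ _ _ (fun=> set0)).
by rewrite m0 eseries0 ?lte_fin.
Qed.

Lemma locally_approximableC (R : realType) (X : Type) (A : set (set X))
    (m : set X -> \bar R) :
  algebra_of_sets A -> setC_closed (locally_approximable A m).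
Proof.
move=> [_ _ AC] E ME C CA e e0; have [B AB lte] := ME C CA e e0.
exists (~` B); first exact: AC.
suff -> : local_dist A m C (~` E) (~` B) = local_dist A m C E B by [].
by rewrite /local_dist /setY !setDE !setCK setUC [X in X `|` _]setIC [X in _ `|` X]setIC.
Qed.

Lemma locally_approximable_bigcup (R : realType) (X : Type) (A : set (set X))
    (m : set X -> \bar R) (E : (set X)^nat) :
  algebra_of_sets A -> measure_on A m ->
  (forall n, locally_approximable A m (E n)) ->
  locally_approximable A m (\bigcup_n E n).
Proof.
move=> hA hm ME C [AC Coo] e e0; have [_ m0 _] := hm.
(* Subadditivity gives only a weak inequality; aiming at e / 2 makes it strict
   for e. *)
pose d : R := (e / 2)%R.
have d0 : (0 < d)%R by rewrite divr_gt0.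
have dn n : (0 < d / (2 ^ n.+1)%:R)%R by rewrite divr_gt0// ltr0n expn_gt0.
(* The errors are terms d / 2 ^ n.+1 of a geometric series of sum d: the term 0
   is kept for the tail of the D n, hence the shift to n.+2 here. *)
have /choice[B /all_and2[AB dB]] n : exists B, A B /\
    local_dist A m C (E n) B < (d / (2 ^ n.+2)%:R)%:E.
  by have [B AB dB] := ME n C (conj AC Coo) _ (dn n.+1); exists B.
pose D n := C `&` B n.
have AD n : A (D n) by exact: algebra_of_setsI.
have ADU := algebra_of_sets_seqDU hA AD.
have [N tailN] : exists N, \sum_(N <= n <oo) m (seqDU D n) < (d / (2 ^ 1)%:R)%:E.
  have Doo : \sum_(n <oo) m (seqDU D n) < +oo.
    apply: le_lt_trans Coo; apply: (measure_on_seqDU_le hA hm AD AC) => n.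
    exact: subIsetl.
  have := nneseries_tail_cvg Doo (fun n _ => m0 _ (ADU n)).
  move=> /(_ [set x | x < (d / (2 ^ 1)%:R)%:E])[|N _ sN].
    by apply: open_ereal_lt'; rewrite lte_fin.
  by exists N; exact: (sN N (leqnn N)).
exists (\big[setU/set0]_(k < N) D k); first exact: (algebra_of_sets_bigsetU hA AD).
pose S n := if n is k.+1 then C `&` (E k `+` B k)
            else \bigcup_n seqDU D (n + N)%N.
apply: (@le_lt_trans _ _ d%:E); last first.
  by rewrite lte_fin /d ltr_pdivrMr// ltr_pMr// ltr1n.
apply: (@le_trans _ _ (outer A m (\bigcup_n S n))).
  apply: le_outer; apply: subset_trans (@bigcup_setY_sub X C E B N) _.
  by move=> x [Dx|[n _ EBx]]; [exists 0%N|exists n.+1].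
apply: le_trans (epsilon_trick0 xpredT (ltW d0)).
apply: outer_bigcup_le => // -[|n]; last exact: dB.
apply: le_lt_trans tailN.
rewrite -(nneseries_addn N); last by move=> n; exact: m0.
exact: outer_le_cover.
Qed.

Theorem theorem1p1 (R : realType) (X : Type) (A : set (set X))
    (m : set X -> \bar R)
    (hA : algebra_of_sets A) (hm : measure_on A m) :
  sigma_algebra setT (locally_approximable A m) /\
  A `<=` locally_approximable A m.
Proof.
have AM := locally_approximable_sub hA hm.
split=> //; split.
- by apply: AM; case: hA.
- by move=> E ME; rewrite setTD; exact: locally_approximableC.
- by move=> E ME; exact: locally_approximable_bigcup.
Qed.
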